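(* Let $X$ be a real or complex Banach space and let $\mathfrak A$ be a unital, norm-closed, strictly semi-transitive subalgebra of $\mathcal L(X)$. Then every $\mathfrak A$-invariant linear subspace $Y$ of $X$ is norm-closed. Furthermore, $Y=\mathfrak A x$ for some $x\in X$.
   Context: $\mathcal L(X)$ is the algebra of all bounded linear operators on $X$; unital means that $\mathfrak A$ contains the identity operator. A linear subspace is not assumed to be closed; $Y$ is $\mathfrak A$-invariant if $AY\subseteq Y$ for all $A\in\mathfrak A$. For $x\in X$, $\mathfrak A x=\{Ax\mid A\in\mathfrak A\}$. $\mathfrak A$ is strictly semi-transitive if for all non-zero $x,y\in X$ there exists $A\in\mathfrak A$ such that $Ax=y$ or $Ay=x$. *)

(* Defs.v *)
From HB Require Import structures.
From mathcomp Require Import all_boot all_order all_algebra.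
From mathcomp Require Import all_classical all_reals all_analysis.
From mathcomp Require Import complex.

Set Implicit Arguments.
Unset Strict Implicit.
Unset Printing Implicit Defensive.

Import Order.TTheory GRing.Theory Num.Theory.
Import numFieldNormedType.Exports.

Local Open Scope classical_set_scope.
Local Open Scope ring_scope.

Variant scalar_kind := RealScalars | ComplexScalars.

Definition scalars (R : realType) (k : scalar_kind) : numFieldType :=
  match k with RealScalars => R | ComplexScalars => R[i]%C end.

Definition scalar_re (R : realType) (k : scalar_kind) : scalars R k -> R :=
  match k return scalars R k -> R with
  | RealScalars => fun a => a
  | ComplexScalars => fun a => complex.Re a
  end.

Definition linear_subspace (K : numFieldType) (V : lmodType K) (S : set V) :=
  submod_closed [in S].

Section Operators.
Context {R : realType} {k : scalar_kind} {X : normedModType (scalars R k)}.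
Implicit Types (f g : X -> X) (A : set (X -> X)) (Y : set X).

(* [`|x|] is a scalar (a nonnegative element of [R[i]] in the complex case),
   hence the passage to its real part. *)
Definition rnorm (x : X) : R := scalar_re `|x|.

(* The algebra L(X), as a set of maps. *)
Definition bounded_operators : set (X -> X) :=
  [set f | linear f /\ exists M : R, forall x, rnorm (f x) <= M * rnorm x].

Definition opnorm f : R := sup [set rnorm (f x) | x in [set x | rnorm x <= 1]].

Definition operator_subalgebra A :=
  [/\ A `<=` bounded_operators,
      linear_subspace A
    & forall f g, A f -> A g -> A (f \o g)].

Definition unital A := A idfun.

(* Closedness in L(X), for the metric given by the operator norm. *)
Definition opnorm_closed A :=
  forall f, bounded_operators f ->
    (forall e : R, 0 < e -> exists2 g, A g & opnorm (f - g) < e) -> A f.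

Definition strictly_semitransitive A :=
  forall x y : X, x != 0 -> y != 0 -> exists2 f, A f & f x = y \/ f y = x.

Definition operator_invariant A Y := forall f, A f -> f @` Y `<=` Y.

Definition operator_orbit A (x : X) : set X := [set f x | f in A].

End Operators.

(* Main.v *)
(* Let Z be the closure of Y and let A_n be the set of operators in A with
   bound n. The set H_n of pairs (z, u) of Z * Z such that z is in the closure
   of A_n u is closed, and by strict semi-transitivity the H_n and their
   transposes cover Z * Z. Baire's theorem gives balls around z0 and u0 whose
   product lies in some H_n. By subtraction, for u near u0 the closure of
   A_(2n) u contains a ball around 0 of Z, so, as in the open mapping theorem,
   A u = Z because A is complete. As Y is dense in Z, one such u lies in Y,
   whence Z = A u is included in Y. *)
Require Import Defs.
From mathcomp Require Import all_boot all_order all_algebra.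
From mathcomp Require Import all_classical all_reals all_analysis.
From mathcomp Require Import complex lra.
Import Order.TTheory GRing.Theory Num.Theory.
Import numFieldNormedType.Exports.

Local Open Scope classical_set_scope.
Local Open Scope ring_scope.

(** * Real parts of scalars and the embedding of the reals *)

Definition scalar_of_real (R : realType) (k : scalar_kind) : R -> scalars R k :=
  match k return R -> scalars R k with
  | RealScalars => fun t => t
  | ComplexScalars => fun t => t%:C%C
  end.

(** Nonnegative complex scalars have zero imaginary part, so the order between them is decided by
    real parts. *)
Lemma scalar_re_lt (R : realType) (k : scalar_kind) (a b : scalars R k) :
  0 <= a -> 0 <= b -> (scalar_re a < scalar_re b) = (a < b).
Proof.
case: k a b => //= a b; rewrite !lecE ltcE => /andP[/eqP-> _] /andP[/eqP-> _].
by rewrite eqxx.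
Qed.

Lemma scalar_reD (R : realType) (k : scalar_kind) (a b : scalars R k) :
  scalar_re (a + b) = scalar_re a + scalar_re b.
Proof. by case: k a b => //= -[? ?] [? ?]. Qed.

Lemma scalar_re_le (R : realType) (k : scalar_kind) (a b : scalars R k) :
  a <= b -> scalar_re a <= scalar_re b.
Proof. by case: k a b => //= a b; rewrite lecE => /andP[]. Qed.

Lemma scalar_re_ge0 (R : realType) (k : scalar_kind) (a : scalars R k) :
  0 <= a -> 0 <= scalar_re a.
Proof. by case: k a => //= a; rewrite lecE => /andP[]. Qed.

Lemma scalar_of_realM (R : realType) (k : scalar_kind) (s t : R) :
  scalar_of_real R k (s * t) = scalar_of_real R k s * scalar_of_real R k t.
Proof. by case: k => //=; rewrite rmorphM. Qed.

Lemma scalar_of_real1 (R : realType) (k : scalar_kind) :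
  scalar_of_real R k 1 = 1.
Proof. by case: k. Qed.

Lemma scalar_reM (R : realType) (k : scalar_kind) (a b : scalars R k) :
  0 <= a -> scalar_re (a * b) = scalar_re a * scalar_re b.
Proof.
by case: k a b => //= -[a a'] [b b']; rewrite lecE /= => /andP[/eqP-> _]; simpc.
Qed.

Lemma scalar_of_real_norm (R : realType) (k : scalar_kind) (t : R) :
  scalar_re `|scalar_of_real R k t| = `|t|.
Proof. by case: k => //=; rewrite expr0n /= addr0 sqrtr_sqr. Qed.

Lemma scalar_of_real_gt0 (R : realType) (k : scalar_kind) (t : R) :
  (0 < scalar_of_real R k t) = (0 < t).
Proof. by case: k => //=; rewrite ltcR. Qed.

Lemma scalar_of_realK (R : realType) (k : scalar_kind) (t : R) :
  scalar_re (scalar_of_real R k t) = t.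
Proof. by case: k. Qed.

Lemma scalar_re_gt0 (R : realType) (k : scalar_kind) (a : scalars R k) :
  0 < a -> 0 < scalar_re a.
Proof. by case: k a => //= a; rewrite ltcE => /andP[]. Qed.

(** * The real-valued norm and its topology *)

Section Norm.
Context {R : realType} {k : scalar_kind} {X : normedModType (scalars R k)}.
Implicit Types x y z : X.

Lemma rnorm_ge0 x : 0 <= rnorm x.
Proof. exact/scalar_re_ge0/normr_ge0. Qed.

Lemma rnorm_lt x (e : R) : (`|x| < scalar_of_real R k e) = (rnorm x < e).
Proof.
have [e0|e0] := ltP 0 e.
  rewrite -scalar_re_lt ?normr_ge0 ?ltW ?scalar_of_real_gt0//.
  by rewrite scalar_of_realK.
(* For [e <= 0] both inequalities are false. *)
rewrite (le_gtF (le_trans e0 (rnorm_ge0 x))).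
apply/negbTE/negP => h; have := le_lt_trans (normr_ge0 x) h.
by rewrite scalar_of_real_gt0 ltNge e0.
Qed.

Lemma rnormD x y : rnorm (x + y) <= rnorm x + rnorm y.
Proof. by rewrite /rnorm -scalar_reD; exact/scalar_re_le/ler_normD. Qed.

Lemma rnormB x y : rnorm (x - y) = rnorm (y - x).
Proof. by rewrite /rnorm distrC. Qed.

Lemma rnorm_subD x y : rnorm (x - y) <= rnorm x + rnorm y.
Proof. by rewrite /rnorm -scalar_reD; exact/scalar_re_le/ler_normB. Qed.

Lemma rnorm0 : rnorm (0 : X) = 0.
Proof. by rewrite /rnorm normr0; case: (k). Qed.

Lemma rnormZ a x : rnorm (a *: x) = scalar_re `|a| * rnorm x.
Proof. by rewrite /rnorm normrZ scalar_reM. Qed.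

Lemma rnorm_distD y x z : rnorm (x - z) <= rnorm (x - y) + rnorm (y - z).
Proof. by rewrite -[x - z](subrKA y) rnormD. Qed.

Lemma rnorm_eq0 x : (forall e : R, 0 < e -> rnorm x <= e) -> x = 0.
Proof.
move=> h; have [//|] := eqVneq x 0; rewrite -normr_gt0.
move=> /scalar_re_gt0; rewrite -/(rnorm x) => x0.
by have := h _ (divr_gt0 x0 (ltr0Sn R 1)); rewrite leNgt ltr_pdivrMr ?ltr_pMr ?ltr1n.
Qed.

(** Positive scalars are real even in the complex case, so balls of real radius form a basis of
    neighbourhoods. *)
Lemma closure_rnormP (Y : set X) x :
  closure Y x <-> forall e : R, 0 < e -> exists2 y, Y y & rnorm (y - x) < e.
Proof.
split=> [Yx e e0|h B].
  have [] := Yx (ball x (scalar_of_real R k e)).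
    by apply: nbhsx_ballx; rewrite scalar_of_real_gt0.
  move=> y [Yy]; rewrite -ball_normE /= rnorm_lt => xy.
  by exists y => //; rewrite rnormB.
rewrite -nbhs_nbhs_norm => -[/= e e0 eB].
have re0 := scalar_re_gt0 _ _ _ e0.
have [y Yy yx] := h _ re0; exists y; split=> //; apply: eB => /=.
by rewrite -scalar_re_lt ?normr_ge0 ?(ltW e0)// -/(rnorm _) rnormB.
Qed.
End Norm.

(** * Completeness, dependent choice and Baire's theorem *)

Lemma rnorm_complete (R : realType) (k : scalar_kind)
    (X : completeNormedModType (scalars R k)) (u : nat -> X) (c : nat -> R) :
  (forall e : R, 0 < e -> exists n, c n < e) ->
  (forall m n, (m <= n)%N -> rnorm (u n - u m) <= c m) ->
  exists l, forall n, rnorm (l - u n) <= c n.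
Proof.
move=> c0 cu.
have scvg : cvg (u @ \oo).
  apply: cauchy_cvg; apply: cauchy_exP => e e0.
  have re0 := scalar_re_gt0 _ _ _ e0.
  have [m me] := c0 _ re0; exists (u m); exists m => // n /= mn.
  rewrite -ball_normE /= -scalar_re_lt ?normr_ge0 ?(ltW e0)// -/(rnorm _) rnormB.
  exact: le_lt_trans (cu _ _ mn) me.
exists (lim (u @ \oo)) => m; apply/ler_addgt0Pr => e e0.
have /cvgrPdist_lt/(_ (scalar_of_real R k e)) := scvg.
rewrite scalar_of_real_gt0 => /(_ e0)[N _ /(_ (maxn N m) (leq_maxl _ _))].
rewrite /= rnorm_lt => /ltW h.
apply: le_trans (rnorm_distD (u (maxn N m)) _ _) _.
by rewrite addrC lerD// cu// leq_maxr.
Qed.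

(** Dependent choice: a successor is chosen for every pair of an index and a point, with a dummy
    value where [P] fails, and then iterated from [x0]. *)
Lemma invariant_choice (T : Type) (P : nat -> T -> Prop)
    (Q : nat -> T -> T -> Prop) (x0 : T) :
  P 0 x0 -> (forall n x, P n x -> exists2 y, P n.+1 y & Q n x y) ->
  exists2 f : nat -> T, f 0 = x0 & forall n, P n (f n) /\ Q n (f n) (f n.+1).
Proof.
move=> P0 step.
have /choice[g gP] : forall s : nat * T, exists y,
    P s.1 s.2 -> P s.1.+1 y /\ Q s.1 s.2 y.
  move=> [n x]; have [/step[y Py Qy]|nP] := pselect (P n x); first by exists y.
  by exists x => /nP.
pose f := fix f n := if n is m.+1 then g (m, f m) else x0.
exists f => // n; have Pf : P n (f n).
  by elim: n => // n /(gP (n, f n))[].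
by split=> //; have [] := gP (n, f n) Pf.
Qed.

Lemma expr_half_lt (R : realType) (c e : R) :
  0 < e -> exists n : nat, c * 2^-1 ^+ n < e.
Proof.
move=> e0; exists (Num.bound (c / e)).
rewrite exprVn ltr_pdivrMr ?exprn_gt0// mulrC -ltr_pdivrMr//.
exact: upper_nthrootP.
Qed.

(** If no [G n] contained a product of balls, nested pairs of balls could be chosen so that step [n]
    avoids [G n]; their centres would converge to a pair in no [G n]. The third hypothesis is
    relative closedness of [G n]. *)
Lemma baire_pairs (R : realType) (k : scalar_kind)
    (X : completeNormedModType (scalars R k)) (Z : set X)
    (G : nat -> X -> X -> Prop) (x0 : X) :
  closed Z -> Z x0 ->
  (forall n z u, Z z -> Z u -> ~ G n z u -> exists2 r : R, 0 < r &
    forall z' u', Z z' -> Z u' -> rnorm (z' - z) <= r -> rnorm (u' - u) <= r ->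
      ~ G n z' u') ->
  (forall z u, Z z -> Z u -> exists n, G n z u) ->
  exists n z0 u0 (r : R), [/\ Z z0, Z u0, 0 < r &
    forall z u, Z z -> Z u -> rnorm (z - z0) < r -> rnorm (u - u0) < r -> G n z u].
Proof.
move=> Zcl Zx0 Gcl Gcov; apply: contrapT => noball.
pose P n (s : X * X * R) := [/\ Z s.1.1, Z s.1.2, 0 < s.2 & s.2 <= 2^-1 ^+ n].
(* The first two conditions nest the closed balls; the third keeps the new pair of balls clear of
   [G n]. *)
pose Q n (s s' : X * X * R) :=
  [/\ rnorm (s'.1.1 - s.1.1) + s'.2 <= s.2,
      rnorm (s'.1.2 - s.1.2) + s'.2 <= s.2 &
      forall z u, Z z -> Z u -> rnorm (z - s'.1.1) <= s'.2 ->
        rnorm (u - s'.1.2) <= s'.2 -> ~ G n z u].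
have [||f _ fP] := invariant_choice _ P Q (x0, x0, 1).
- by split; rewrite //= expr0.
- move=> n [[z u] r] [/= Zz Zu r0 rn].
  have [z' [u' [Zz' Zu' zz uu nG]]] : exists z' u', [/\ Z z', Z u',
      rnorm (z' - z) < r / 2, rnorm (u' - u) < r / 2 & ~ G n z' u'].
    apply: contrapT => h; apply: noball; exists n, z, u, (r / 2).
    split=> //; first by rewrite divr_gt0.
    move=> z' u' Zz' Zu' zz uu; apply: contrapT => nG.
    by apply: h; exists z', u'.
  have [r' r'0 r'G] := Gcl _ _ _ Zz' Zu' nG.
  (* [r / 2] leaves room for the shift of the centres and halves the radius bound; [r'] keeps clear
     of [G n]. *)
  exists (z', u', Num.min r' (r / 2)).
    split=> //=; first by rewrite lt_min r'0 divr_gt0.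
    by rewrite ge_min exprS mulrC; apply/orP; right; rewrite ler_pM2r ?invr_gt0.
  have m1 : Num.min r' (r / 2) <= r / 2 by rewrite ge_min lexx orbT.
  have m2 : Num.min r' (r / 2) <= r' by rewrite ge_min lexx.
  split=> /=; [by lra|by lra|].
  move=> z1 u1 Zz1 Zu1 zz1 uu1.
  by apply: r'G => //; [exact: le_trans zz1 m2|exact: le_trans uu1 m2].
have lim (p : X * X * R -> X) :
    (forall n, rnorm (p (f n.+1) - p (f n)) + (f n.+1).2 <= (f n).2) ->
    (forall n, Z (p (f n))) ->
    exists2 l, Z l & forall n, rnorm (l - p (f n)) <= (f n).2.
  move=> pf Zp; have small e : 0 < e -> exists n, (f n).2 < e.
    move=> e0; have [n ne] := expr_half_lt R 1 e e0; exists n.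
    by rewrite mul1r in ne; apply: le_lt_trans ne; have [[]] := fP n.
  have [//|m n /subnK <-|l lP] :=
      rnorm_complete _ _ _ (fun n => p (f n)) (fun n => (f n).2).
    (* Keeping the later radius on the left lets the nesting telescope. *)
    have h : rnorm (p (f (n - m + m)%N) - p (f m)) + (f (n - m + m)%N).2 <= (f m).2.
      elim: (n - m)%N => [|d IH]; first by rewrite subrr rnorm0 add0r.
      have := rnorm_distD (p (f (d + m)%N)) (p (f (d.+1 + m)%N)) (p (f m)).
      by have := pf (d + m)%N; rewrite -addSn; lra.
    by have [[_ _ r0 _] _] := fP (n - m + m)%N; lra.
  exists l => //; apply: Zcl; apply/closure_rnormP => e e0.
  have [n ne] := small _ e0; exists (p (f n)) => //.
  by rewrite rnormB; apply: le_lt_trans ne.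
have [||z Zz zf] := lim (fun s => s.1.1).
- by move=> n; have [_ []] := fP n.
- by move=> n; have [[]] := fP n.
have [||u Zu uf] := lim (fun s => s.1.2).
- by move=> n; have [_ []] := fP n.
- by move=> n; have [[]] := fP n.
(* The limit pair lies in the balls of stage [n.+1], which avoid [G n]. *)
have [n] := Gcov _ _ Zz Zu.
by have [_ [_ _ h]] := fP n; apply: h.
Qed.

Lemma linear_subspaceP (K : numFieldType) (V : lmodType K) (S : set V) :
  linear_subspace S ->
  S 0 /\ forall a x y, S x -> S y -> S (a *: x + y).
Proof.
move=> [S0 SD]; split=> [|a x y Sx Sy]; first by rewrite inE in S0.
by have := SD a x y; rewrite !inE; apply.
Qed.

(** * Limits of operators, orbits and generators *)

Section Operators.
Context {R : realType} {k : scalar_kind} {X : completeNormedModType (scalars R k)}.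
Implicit Types (f g : X -> X) (A : set (X -> X)) (Z : set X).

Definition bounded_by f (M : R) := forall x, rnorm (f x) <= M * rnorm x.

Lemma opnorm_le f M : 0 <= M -> bounded_by f M -> opnorm f <= M.
Proof.
move=> M0 fM; apply: ge_sup.
  by exists (rnorm (f 0)); exists 0 => //=; rewrite rnorm0.
move=> _ [x /= x1 <-]; apply: le_trans (fM x) _.
by rewrite -[leRHS]mulr1 ler_wpM2l.
Qed.

(** Meant for a pointwise limit [f], not yet known to be an operator: linearity and boundedness are
    inherited from the [f_ n], and then closedness of [A] applies. *)
Lemma opnorm_closed_lim A (f_ : nat -> X -> X) (c : nat -> R) f :
  A `<=` bounded_operators -> opnorm_closed A ->
  (forall n, A (f_ n)) ->
  (forall e : R, 0 < e -> exists n, c n < e) ->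
  (forall n, bounded_by (f - f_ n) (c n)) -> A f.
Proof.
move=> Abnd Acl Af c0 fc; apply: Acl; last first.
  move=> e e0; have [n cn] := c0 (e / 2) (divr_gt0 e0 (ltr0Sn R 1)).
  exists (f_ n) => //; apply: (@le_lt_trans _ _ (e / 2)); last by lra.
  apply: opnorm_le => [|x]; first by lra.
  by apply: le_trans (fc n x) _; rewrite ler_wpM2r ?rnorm_ge0 ?ltW.
split; last first.
  have [_ [M fM]] := Abnd _ (Af 0); exists (M + c 0) => x.
  rewrite -[f x](subrK (f_ 0 x)); apply: le_trans (rnormD _ _) _.
  by have := fc 0 x; have := fM x; rewrite -[(f - f_ 0) x]/(f x - f_ 0 x); lra.
move=> a x y; apply/subr0_eq/rnorm_eq0 => e e0.
(* [K] collects the norms multiplying [c n] in the linearity defect; [K + 1] avoids a zero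
   denominator. *)
pose K := rnorm (a *: x + y) + scalar_re `|a| * rnorm x + rnorm y.
have K0 : 0 <= K by rewrite /K -rnormZ !addr_ge0 ?rnorm_ge0.
have [n cn] := c0 (e / (K + 1)) (divr_gt0 e0 (ltr_wpDl K0 ltr01)).
have [flin _] := Abnd _ (Af n).
(* As [f_ n] is linear, [f] and [f - f_ n] have the same linearity defect. *)
have -> : f (a *: x + y) - (a *: f x + f y) = (f - f_ n) (a *: x + y)
    - (a *: (f - f_ n) x + (f - f_ n) y).
  rewrite -![(f - f_ n) _]/(f _ - f_ n _) flin scalerBr.
  rewrite [X in _ = _ - X]addrACA.
  by rewrite -opprD opprB addrA subrK.
have h1 := rnorm_subD ((f - f_ n) (a *: x + y)) (a *: (f - f_ n) x + (f - f_ n) y).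
have h2 := rnormD (a *: (f - f_ n) x) ((f - f_ n) y).
rewrite rnormZ in h2.
have h3 : scalar_re `|a| * rnorm ((f - f_ n) x) <= scalar_re `|a| * (c n * rnorm x).
  by rewrite ler_wpM2l ?fc//; exact/scalar_re_ge0/normr_ge0.
have h : c n * K <= e / (K + 1) * (K + 1).
  apply: le_trans (_ : e / (K + 1) * K <= _).
    by rewrite ler_wpM2r// ltW.
  by rewrite ler_wpM2l ?lerDl// divr_ge0 ?ltW ?ltr_wpDl.
rewrite divfK ?gt_eqF ?ltr_wpDl// /K in h.
by have := fc n (a *: x + y); have := fc n y; lra.
Qed.

(* The open mapping argument: the approximate solutions [a] at scales
   [2^-n] sum up to an operator in [A]. *)
Lemma orbit_full_of_approx A Z (u : X) (r C : R) :
  operator_subalgebra A -> opnorm_closed A ->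
  linear_subspace Z -> operator_invariant A Z -> Z u -> 0 < r -> 0 <= C ->
  (forall w (e : R), Z w -> rnorm w < r -> 0 < e ->
    exists a, [/\ A a, bounded_by a C & rnorm (w - a u) < e]) ->
  forall w, Z w -> exists2 a, A a & a u = w.
Proof.
move=> [Abnd Asub _] Acl /linear_subspaceP[Z0 ZD] Zinv Zu r0 C0 approx w Zw.
have [A0 AD] := linear_subspaceP _ _ _ Asub.
have ZB x y : Z x -> Z y -> Z (x - y).
  by move=> Zx Zy; rewrite addrC -scaleN1r; exact: ZD.
(* Scaling by [t] carries the approximation from radius [r] to [t * r], with bound [t * C]. *)
have scaled t v e : 0 < t -> Z v -> rnorm v < t * r -> 0 < e ->
    exists a, [/\ A a, bounded_by a (t * C) & rnorm (v - a u) < e].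
  move=> t0 Zv vtr e0; pose T := scalar_of_real R k t.
  pose T' := scalar_of_real R k t^-1.
  have TT' : T * T' = 1 by rewrite -scalar_of_realM divff ?gt_eqF ?scalar_of_real1.
  have [|||a [Aa aC vau]] := approx (T' *: v) (e / t).
  - by rewrite -[_ *: _]addr0; exact: ZD.
  - rewrite rnormZ scalar_of_real_norm gtr0_norm ?invr_gt0//.
    by rewrite mulrC ltr_pdivrMr// mulrC.
  - exact: divr_gt0.
  exists (T *: a); split.
  - by rewrite -[_ *: _]addr0; exact: AD.
  - move=> x; rewrite -[(T *: a) x]/(T *: a x) rnormZ scalar_of_real_norm gtr0_norm//.
    by rewrite -mulrA ler_wpM2l ?(ltW t0) ?aC.
  - have -> : v - (T *: a) u = T *: (T' *: v - a u).
      by rewrite scalerBr scalerA TT' scale1r.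
    by rewrite rnormZ scalar_of_real_norm gtr0_norm// mulrC -ltr_pdivlMr.
(* The added [1] makes [rnorm w < t * r] strict and [t] positive even when [w] is zero. *)
pose t := rnorm w / r + 1.
have t0 : 0 < t by rewrite ltr_wpDl// divr_ge0 ?rnorm_ge0 ?ltW.
have wtr : rnorm w < t * r.
  by rewrite mulrDl divfK ?gt_eqF// mul1r ltrDl.
pose P n a := A a /\ rnorm (w - a u) < t * 2^-1 ^+ n * r.
pose Q n (a b : X -> X) := bounded_by (b - a) (t * 2^-1 ^+ n * C).
have [||f f0 fP] := invariant_choice _ P Q 0.
- by split; rewrite // expr0 mulr1 subr0.
- move=> n a [Aa aw].
  have tn0 m : 0 < t * 2^-1 ^+ m by rewrite mulr_gt0 ?exprn_gt0 ?invr_gt0.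
  (* The residual [w - a u] is approximated at scale [t * 2^-1 ^+ n], with the next residual bound
     as tolerance. *)
  have [|b [Ab bC wb]] := scaled _ _ (t * 2^-1 ^+ n.+1 * r) (tn0 n) _ aw (mulr_gt0 (tn0 _) r0).
    by apply: ZB => //; apply: (Zinv a) => //; exists u.
  exists (b + a); last by rewrite /Q addrK.
  split; first by rewrite -[b]scale1r; exact: AD.
  by rewrite -[(b + a) u]/(b u + a u) opprD addrCA addrC.
have fD n m x : (m <= n)%N ->
    rnorm (f n x - f m x) <= 2 * (t * 2^-1 ^+ m * C) * rnorm x.
  move=> /subnK <-.
  (* The remaining tail of the geometric series is added on the left so that the induction
     telescopes. *)
  suff : rnorm (f (n - m + m)%N x - f m x) +
      2 * (t * 2^-1 ^+ (n - m + m)%N * C) * rnorm x <=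
      2 * (t * 2^-1 ^+ m * C) * rnorm x.
    apply: le_trans; rewrite lerDl.
    by rewrite !mulr_ge0 ?rnorm_ge0 ?exprn_ge0 ?invr_ge0 ?(ltW t0).
  elim: (n - m)%N => [|d IH]; first by rewrite subrr rnorm0 add0r.
  have [_ /(_ x)] := fP (d + m)%N; rewrite -[(_ - _) x]/(_ x - _ x) => h.
  have := rnorm_distD (f (d + m)%N x) (f (d.+1 + m)%N x) (f m x).
  by rewrite addSn exprS; lra.
have small c e : 0 < e -> exists n : nat, c * (t * 2^-1 ^+ n) < e.
  move=> e0; have [n h] := expr_half_lt R (c * t) e e0.
  by exists n; rewrite mulrA.
have /choice[g gP] : forall x, exists l,
    forall n, rnorm (l - f n x) <= 2 * (t * 2^-1 ^+ n * C) * rnorm x.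
  move=> x.
  apply: (rnorm_complete _ _ _ (fun n => f n x)) => [e e0|m n mn]; last exact: fD.
  have [n h] := small (2 * C * rnorm x) e e0; exists n.
  by apply: le_lt_trans h; lra.
exists g.
  apply: (opnorm_closed_lim _ f (fun n => 2 * (t * 2^-1 ^+ n * C))) => //.
  - by move=> n; have [[]] := fP n.
  - move=> e e0; have [n h] := small (2 * C) e e0; exists n.
    by apply: le_lt_trans h; lra.
  - by move=> n x; exact: gP.
apply/subr0_eq/rnorm_eq0 => e e0.
have [n h] := small (2 * C * rnorm u + r) e e0.
have [[_ fn] _] := fP n; rewrite rnormB in fn.
have := rnorm_distD (f n u) (g u) w; have := gP u n; lra.
Qed.

(** A whole ball of generators, rather than a single one, makes it possible to pick one in a dense
    subset of [Z]. *)
Lemma generators_ball A Z :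
  operator_subalgebra A -> opnorm_closed A -> strictly_semitransitive A ->
  linear_subspace Z -> operator_invariant A Z -> closed Z ->
  exists u0 (r : R), [/\ Z u0, 0 < r & forall u, Z u -> rnorm (u - u0) < r ->
    Z `<=` operator_orbit A u].
Proof.
move=> Aalg Acl Asst Zsub Zinv Zcl; have [Abnd Asub _] := Aalg.
have [A0 AD] := linear_subspaceP _ _ _ Asub.
have [Z0 ZD] := linear_subspaceP _ _ _ Zsub.
pose H (n : nat) z u := forall e : R, 0 < e ->
  exists a, [/\ A a, bounded_by a n%:R & rnorm (z - a u) < e].
have Hcl n z u : ~ H n z u -> exists2 r : R, 0 < r &
    forall z' u', rnorm (z' - z) <= r -> rnorm (u' - u) <= r -> ~ H n z' u'.
  move=> /existsNP[e /not_implyP[e0 nH]].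
  have n2 : 0 < (n.+2)%:R :> R by [].
  (* Returning from [z'] and [u'] to [z] and [u] costs [d] and [n * d], and the approximation one
     more [d]: hence [n + 2]. *)
  have [d d0 ed] : exists2 d : R, 0 < d & e = (n%:R + 2) * d.
    exists (e / n.+2%:R); first exact: divr_gt0.
    by rewrite -natrD addn2 mulrC divfK ?gt_eqF.
  exists d => // z' u' zz uu /(_ _ d0)[a [Aa an h]].
  apply: nH; exists a; split=> //.
  have [alin _] := Abnd _ Aa.
  have au : rnorm (a u' - a u) <= n%:R * d.
    have -> : a u' - a u = a (u' - u).
      by rewrite addrC -scaleN1r -alin scaleN1r addrC.
    by apply: le_trans (an _) _; rewrite ler_wpM2l.
  have := rnorm_distD z' z (a u); have := rnorm_distD (a u') z' (a u).
  by rewrite rnormB in zz; lra.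
have Hcov a u : A a -> exists n, H n (a u) u.
  move=> Aa; have [_ [M aM]] := Abnd _ Aa; exists (Num.bound `|M|) => e e0.
  exists a; split=> //; last by rewrite subrr rnorm0.
  move=> x; apply: le_trans (aM x) _; rewrite ler_wpM2r ?rnorm_ge0//.
  by apply: le_trans (ler_norm M) _; apply/ltW/archi_boundP.
(* Odd indices carry the [H n] and even ones their transposes, giving one sequence for Baire's
   theorem. *)
pose G n z u := if odd n then H n./2 z u else H n./2 u z.
have [n [z0 [u0 [r [Zz0 Zu0 r0 Hball]]]]] : exists n z0 u0 (r : R),
    [/\ Z z0, Z u0, 0 < r & forall z u, Z z -> Z u ->
      rnorm (z - z0) < r -> rnorm (u - u0) < r -> H n z u].
  have [||n [z0 [u0 [r [Zz0 Zu0 r0]]]]] := baire_pairs _ _ _ Z G 0 Zcl Z0.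
  - move=> n z u _ _; rewrite /G; case: ifP => _ /Hcl[r r0 h]; exists r => // z' u' _ _ ? ?.
      exact: h.
    exact: h.
  (* Strict semi-transitivity concerns non-zero vectors only; if one vector is zero, the zero
     operator sends the other to it. *)
  - move=> z u Zz Zu; have [z_eq0|zn0] := eqVneq z 0.
      have [n h] := Hcov 0 u A0; exists n.*2.+1.
      by rewrite /G /= odd_double uphalf_double z_eq0.
    have [u_eq0|un0] := eqVneq u 0.
      have [n h] := Hcov 0 z A0; exists n.*2.
      by rewrite /G /= odd_double doubleK u_eq0.
    have [a Aa [<-|<-]] := Asst z u zn0 un0.
      have [n h] := Hcov a z Aa; exists n.*2.
      by rewrite /G /= odd_double doubleK.
    have [n h] := Hcov a u Aa; exists n.*2.+1.
    by rewrite /G /= odd_double uphalf_double.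
  (* For even [n] the two balls swap roles. *)
  rewrite /G; case: (odd n) => h; exists n./2; first by exists z0, u0, r.
  by exists u0, z0, r; split=> // z u *; apply: h.
exists u0, r; split=> // u Zu uu0 w Zw.
suff approx v e : Z v -> rnorm v < r -> 0 < e ->
    exists a, [/\ A a, bounded_by a (n%:R + n%:R) & rnorm (v - a u) < e].
  have [|a Aa <-] := orbit_full_of_approx A Z u r (n%:R + n%:R)
    Aalg Acl Zsub Zinv Zu r0 _ approx w Zw; first by rewrite addr_ge0.
  by exists a.
move=> Zv vr e0.
have e20 : 0 < e / 2 by rewrite divr_gt0.
(* Both [v + z0] and [z0] lie in the ball around [z0]; the difference of the operators found for
   them approximates [v], and the two bounds [n] add up. *)
have [||a [Aa an ha]] := Hball (v + z0) u _ Zu _ uu0 _ e20.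
- by rewrite -[v]scale1r; exact: ZD.
- by rewrite addrK.
have [|b [Ab bn hb]] := Hball z0 u Zz0 Zu _ uu0 _ e20.
  by rewrite subrr rnorm0.
exists (a - b); split.
- by rewrite addrC -scaleN1r; exact: AD.
- move=> x; rewrite -[(a - b) x]/(a x - b x).
  by have := rnorm_subD (a x) (b x); have := an x; have := bn x; lra.
- have -> : v - (a - b) u = (v + z0 - a u) - (z0 - b u).
    rewrite -[(a - b) u]/(a u - b u) !opprB.
    by rewrite [RHS]addrACA (addrAC v) [RHS]addrACA subrr addr0 addrA.
  by have := rnorm_subD (v + z0 - a u) (z0 - b u); lra.
Qed.
End Operators.

(** * Closures of invariant subspaces, and the conclusion *)

Lemma closure_subspace (R : realType) (k : scalar_kind)
    (X : normedModType (scalars R k)) (Y : set X) :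
  linear_subspace Y -> linear_subspace (closure Y).
Proof.
move=> /linear_subspaceP[Y0 YD]; split; first by rewrite inE; exact: subset_closure.
move=> a x y; rewrite !inE => /closure_rnormP Yx /closure_rnormP Yy.
apply/closure_rnormP => e e0.
have a0 : 0 <= scalar_re `|a| by exact/scalar_re_ge0/normr_ge0.
have [|x' Yx' xx] := Yx (e / 2 / (scalar_re `|a| + 1)).
  by rewrite !divr_gt0// ltr_wpDl.
have [|y' Yy' yy] := Yy (e / 2); first by rewrite divr_gt0.
exists (a *: x' + y'); first exact: YD.
rewrite opprD addrACA -scalerBr; apply: le_lt_trans (rnormD _ _) _.
rewrite rnormZ; move: xx; rewrite ltr_pdivlMr ?ltr_wpDl//.
by have := rnorm_ge0 (x' - x); lra.
Qed.

Lemma closure_invariant (R : realType) (k : scalar_kind)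
    (X : normedModType (scalars R k)) (A : set (X -> X)) (Y : set X) :
  A `<=` bounded_operators -> operator_invariant A Y ->
  operator_invariant A (closure Y).
Proof.
move=> Abnd Yinv f Af _ [x /closure_rnormP Yx <-].
apply/closure_rnormP => e e0; have [flin [M fM]] := Abnd _ Af.
have [|y Yy yx] := Yx (e / (`|M| + 1)); first by rewrite divr_gt0// ltr_wpDl.
exists (f y); first by apply: (Yinv f) => //; exists y.
have -> : f y - f x = f (y - x) by rewrite addrC -scaleN1r -flin scaleN1r addrC.
apply: le_lt_trans (fM _) _; move: yx; rewrite ltr_pdivlMr ?ltr_wpDl//.
have : M * rnorm (y - x) <= `|M| * rnorm (y - x).
  by rewrite ler_wpM2r ?rnorm_ge0 ?ler_norm.
by have := rnorm_ge0 (y - x); lra.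
Qed.

Theorem corollary3p9 (R : realType) (k : scalar_kind)
    (X : completeNormedModType (scalars R k)) (A : set (X -> X))
    (A_subalgebra : operator_subalgebra A)
    (A_unital : unital A)
    (A_closed : opnorm_closed A)
    (A_semitransitive : strictly_semitransitive A)
    (Y : set X) (Y_subspace : linear_subspace Y)
    (Y_invariant : operator_invariant A Y) :
  closed Y /\ exists x : X, Y = operator_orbit A x.
Proof.
have [Abnd _ _] := A_subalgebra.
have [u0 [r [/closure_rnormP Yu0 r0 ball_full]]] :=
  generators_ball _ _ A_subalgebra A_closed A_semitransitive
    (closure_subspace _ _ _ _ Y_subspace) (closure_invariant _ _ _ _ _ Abnd Y_invariant)
    (@closed_closure _ Y).
(* The ball of generators of [closure Y] meets [Y], since its centre lies in the closure. *)
have [u Yu uu0] := Yu0 _ r0.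
have orbit_sub : operator_orbit A u `<=` Y.
  by move=> _ [f Af <-]; apply: (Y_invariant f) => //; exists u.
(* Now [closure Y] is contained in the orbit of [u], which is contained in [Y], so all three
   coincide. *)
have clY := ball_full u (subset_closure Yu) uu0.
split; first by move=> y /clY/orbit_sub.
by exists u; apply/seteqP; split=> // y /subset_closure/clY.
Qed.
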